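(* Let $G$ be a block graph all of whose blocks (cliques) have size greater than two. Then for every integer $q\ge 0$, $Z_q(G)=Z(G)$.
   Context: Graphs are finite, simple and undirected. A block graph is a graph in which each maximal connected subgraph that cannot be disconnected by removing a single vertex is a clique; these cliques are called the blocks of the graph, and the size of a block is its number of vertices. The $q$-analogue of zero forcing ($Z_q$ game), for a fixed integer $q\ge 0$, is a game between a player and an oracle on a graph $G$. Initially all vertices are unfilled. The player repeatedly uses the following rules. Rule 1: fill any vertex at the cost of one token. Rule 2 (forcing rule): at no cost, a filled vertex with a unique unfilled neighbor forces that neighbor to be filled. Rule 3: let $F$ be the set of filled vertices and let $U_1,\dots,U_k$ be the connected components of $G[V\setminus F]$; if $k>q$, the player selects at least $q+1$ of the components $U_i$; the oracle then chooses a nonempty subset $\{U_{i_1},\dots,U_{i_l}\}$ of the selected components; the player may then, at no cost, apply the forcing rule in the subgraph of $G$ induced by $F\cup U_{i_1}\cup\dots\cup U_{i_l}$. The number $Z_q(G)$ is the minimum number of tokens with which the player can guarantee to fill all vertices of $G$, against an oracle trying to maximize the number of tokens spent. The zero forcing number $Z(G)$ is the minimum number of tokens needed to fill all vertices of $G$ when only Rules 1 and 2 are allowed. *)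

(* Defs.v *)
From mathcomp Require Import all_boot.
From mathcomp Require Import boolp.

Set Implicit Arguments.
Unset Strict Implicit.
Unset Printing Implicit Defensive.

(* A finite simple graph is a symmetric irreflexive relation e on a finType;  *)
(* subgraphs of the form G[A] are represented by their vertex set A.          *)
Section Graphs.
Variables (T : finType) (e : rel T).
Implicit Types (A B F W : {set T}) (t : nat).

Definition induced A : rel T := [rel x y | [&& x \in A, y \in A & e x y]].

(* Holds vacuously for set0. *)
Definition connected A : bool :=
  [forall x in A, forall y in A, connect (induced A) x y].

Definition components A : {set {set T}} :=
  equivalence_partition (connect (induced A)) A.

Definition clique A : bool :=
  [forall x in A, forall y in A, (x != y) ==> e x y].

Definition nonseparable A : bool :=
  [&& A != set0, connected A & [forall x in A, connected (A :\ x)]].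

(* Adding edges to a nonseparable subgraph keeps it nonseparable, so the      *)
(* maximal nonseparable subgraphs are induced and it is enough to maximize    *)
(* over vertex sets. An isolated vertex is a block of size 1.                 *)
Definition block B : bool := maxset nonseparable B.

Definition block_graph : Prop := forall B, block B -> clique B.

(* In G[W], with filled set F, v is the unique unfilled neighbor of u \in F.  *)
Definition forces W F (u v : T) : bool :=
  (u \in F) && ([set w in W :\: F | e u w] == [set v]).

Inductive forcing_steps W : {set T} -> {set T} -> Prop :=
| ForcingNil F : forcing_steps W F F
| ForcingCons F F' u v :
    forces W F u v -> forcing_steps W (v |: F) F' -> forcing_steps W F F'.

(* From the filled set F, a budget of t tokens suffices to fill every vertex, *)
(* where filling an arbitrary vertex costs one token and forcing is free.     *)
Inductive Z_wins : nat -> {set T} -> Prop :=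
| Z_done t : Z_wins t setT
| Z_fill t F v : Z_wins t (v |: F) -> Z_wins t.+1 F
| Z_force t F u v : forces setT F u v -> Z_wins t (v |: F) -> Z_wins t F.

(* The same with an additional free move, whatever the oracle answers: in     *)
(* Zq_oracle, S is the player's selection of more than q components of        *)
(* G[V \ F], O is the oracle's choice of a nonempty subset of S, and reply O  *)
(* is the filled set after the player has applied the forcing rule, any       *)
(* number of times, in G[F :|: cover O]. Being inductive, the predicate only  *)
(* counts strategies that finish after finitely many moves.                   *)
Inductive Zq_wins (q : nat) : nat -> {set T} -> Prop :=
| Zq_done t : Zq_wins q t setT
| Zq_fill t F v : Zq_wins q t (v |: F) -> Zq_wins q t.+1 F
| Zq_force t F u v :
    forces setT F u v -> Zq_wins q t (v |: F) -> Zq_wins q t F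
| Zq_oracle t F (S : {set {set T}}) (reply : {set {set T}} -> {set T}) :
    S \subset components (~: F) -> q < #|S| ->
    (forall O : {set {set T}}, O \subset S -> O != set0 ->
       forcing_steps (F :|: cover O) F (reply O)) ->
    (forall O : {set {set T}}, O \subset S -> O != set0 -> Zq_wins q t (reply O)) ->
    Zq_wins q t F.

Lemma Z_wins_card F : Z_wins #|~: F| F.
Proof.
move Dn: #|~: F| => n; elim: n F Dn => [|n IHn] F Dn.
  have -> : F = setT by rewrite -[F]setCK (cards0_eq Dn) setC0.
  exact: Z_done.
have [v vF] : exists v, v \in ~: F by apply/card_gt0P; rewrite Dn.
apply: (@Z_fill _ _ v); apply: IHn; apply/eqP.
have -> : ~: (v |: F) = (~: F) :\ v by rewrite setCU setDE setIC.
by have := cardsD1 v (~: F); rewrite vF Dn add1n => -[->].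
Qed.

Lemma Z_wins_Zq q t F : Z_wins t F -> Zq_wins q t F.
Proof.
elim=> {t F} [t|t F v _|t F u v fuv _]; first exact: Zq_done.
  exact: Zq_fill.
exact: Zq_force fuv.
Qed.

Lemma Z_wins_ex : exists t, `[< Z_wins t set0 >].
Proof. by exists #|~: (set0 : {set T})|; apply/asboolP/Z_wins_card. Qed.

Lemma Zq_wins_ex q : exists t, `[< Zq_wins q t set0 >].
Proof.
by exists #|~: (set0 : {set T})|; apply/asboolP/Z_wins_Zq/Z_wins_card.
Qed.

Definition zero_forcing_number : nat := ex_minn Z_wins_ex.

Definition Zq_number (q : nat) : nat := ex_minn (Zq_wins_ex q).

End Graphs.

(* Main.v *)
Require Import Defs.
From mathcomp Require Import all_boot.
From mathcomp Require Import boolp.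

Set Implicit Arguments.
Unset Strict Implicit.
Unset Printing Implicit Defensive.

(** Both numbers equal the number of vertices minus the number of blocks.

    Lower bound for [Zq_number], for every [q]. Each edge lies in a block,
    which is a clique. When [u] forces [v], the whole block containing [u] and
    [v] is filled, because all its unfilled vertices are neighbors of [u], and
    they are adjacent to [v], hence lie in the component that the oracle has
    opened. So every force completes a block that was incomplete
    ([force_completes_block]), there are at most as many forces as blocks, and
    all other vertices cost a token ([Zq_wins_bound]).

    Upper bound for [zero_forcing_number]. The blocks form a forest: every
    nonempty family of blocks contains a leaf, a block meeting all the others
    in at most one vertex [p] ([leaf_block_exists]). Removing leaves one by one
    gives by induction a set of as many vertices as there are blocks which may
    be left unfilled ([white_set]). Indeed a leaf has two vertices [c] and [d]
    other than [p], since its size is greater than two. Leave [c] unfilled: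
    its neighbors all lie in the leaf, and as soon as [p] is filled, [d] forces
    [c], so that the forces available in the rest of the graph still are
    ([add_leaf_wins]).

    The forest structure follows from one fact: two neighbors of [x] that are
    connected in the graph without [x] lie on a cycle through [x], and cycles
    are nonseparable, so some block contains [x] and both of them
    ([block_of_detour]). *)

(** * Blocks of a graph *)

Section Blocks.
Variables (T : finType) (e : rel T).
Hypothesis (e_sym : symmetric e).
Implicit Types (A B F W : {set T}) (P : {set {set T}}).

Lemma connect_induced_sym A : connect_sym (induced e A).
Proof.
by apply: sym_connect_sym => x y; rewrite /induced /= e_sym andbCA.
Qed.

Lemma connected_path x s : path e x s -> connected e [set y in x :: s].
Proof.
set A := [set y in _] => es.
have reach : forall y, y \in A -> connect (induced e A) x y.
  have: forall z t, path e z t -> {subset z :: t <= A} ->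
      forall y, y \in z :: t -> connect (induced e A) z y.
    move=> z t; elim: t z => [|a t IHt] z /=.
      by move=> _ _ y; rewrite inE => /eqP->.
    case/andP=> eza pt sA y; rewrite inE => /predU1P[-> // | yt].
    have za : connect (induced e A) z a.
      by apply: connect1; rewrite /induced /= !sA ?eza // !inE eqxx ?orbT.
    apply: connect_trans za (IHt a pt _ y yt) => w wt.
    by apply: sA; rewrite inE wt orbT.
  by move=> reach y; rewrite [y \in A]inE; apply: (reach _ _ es) => w; rewrite [w \in A]inE.
apply/'forall_implyP => y yA; apply/'forall_implyP => z zA.
by apply: connect_trans (reach z zA); rewrite connect_induced_sym reach.
Qed.

(** Deleting a vertex of a cycle leaves a path: rotate the cycle so that this
    vertex comes first. A single edge counts as a cycle of length two. *)
Lemma nonseparable_cycle x s :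
  cycle e (x :: s) -> uniq (x :: s) -> nonseparable e [set y in x :: s].
Proof.
move=> ec uc; apply/and3P; split.
- by apply/set0Pn; exists x; rewrite !inE eqxx.
- by apply: connected_path; move: ec; rewrite /= rcons_path => /andP[].
apply/'forall_implyP => a; rewrite inE => /rot_to[i s' def_s'].
move: ec uc; rewrite -(rot_cycle i) -(rot_uniq i) def_s' => ec uc.
have -> : [set y in x :: s] :\ a = [set y in s'].
  apply/setP=> y; rewrite in_setD1 !in_set -(mem_rot i) def_s' inE.
  by case: eqP => //= ->; case/andP: uc => /negPf->.
case: s' ec {uc def_s'} => [_|b s'].
  by apply/'forall_implyP => y; rewrite inE.
by rewrite /= rcons_path => /and3P[_ ps _]; apply: connected_path.
Qed.

Lemma clique_nonseparable A : A != set0 -> clique e A -> nonseparable e A.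
Proof.
move=> A0 /'forall_implyP cA.
have con A' : A' \subset A -> connected e A'.
  move=> /subsetP sA'; apply/'forall_implyP => y yA; apply/'forall_implyP => z zA.
  have [-> // | yz] := eqVneq y z; apply: connect1; rewrite /induced /= yA zA /=.
  by move: (cA y (sA' y yA)) => /'forall_implyP/(_ z (sA' z zA)); rewrite yz.
rewrite /nonseparable A0 con //=; apply/'forall_implyP => x _.
by apply: con; rewrite subD1set.
Qed.

Lemma nonseparable_sub_block A :
  nonseparable e A -> exists2 B, block e B & A \subset B.
Proof. by case/maxset_exists=> B bB sAB; exists B. Qed.

(** Close a repetition-free path from [y] to [z] avoiding [x] into a cycle
    through [x]. *)
Lemma block_of_detour x y z :
    e x y -> e x z -> y != x -> connect (induced e (~: [set x])) y z ->
  exists2 B, block e B & [/\ x \in B, y \in B & z \in B].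
Proof.
move=> exy exz yx /connectP[s0 s0P z_last].
rewrite {}z_last in exz *; case/shortenP: s0P exz => s sP us _ exz.
have xs : x \notin y :: s.
  rewrite inE eq_sym negb_or yx /=; apply/negP => xs.
  have: all (mem (~: [set x])) s.
    elim: (s) (y) sP => //= a t IHt b /andP[/and3P[_ -> _]] /=; exact: IHt.
  by move=> /allP/(_ x xs); rewrite !inE eqxx.
have es : path e y s by apply: sub_path sP => a b /and3P[].
have ec : cycle e [:: x, y & s].
  by rewrite /= exy rcons_path es e_sym exz.
have /nonseparable_sub_block[B bB /subsetP sB] :
  nonseparable e [set w in [:: x, y & s]].
  by apply: nonseparable_cycle => //; rewrite cons_uniq xs us.
exists B => //; split; apply: sB; rewrite in_set in_cons ?eqxx //.
  by rewrite mem_head orbT.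
by rewrite mem_last orbT.
Qed.

End Blocks.

(** * The blocks of a block graph form a forest *)

Section BlockGraph.
Variables (T : finType) (e : rel T).
Hypotheses (e_sym : symmetric e) (e_irr : irreflexive e).
Hypothesis (G_block : block_graph e).
Implicit Types (A B F W : {set T}) (P : {set {set T}}).

Lemma block_adj B x y : block e B -> x \in B -> y \in B -> x != y -> e x y.
Proof.
by move=> /G_block/'forall_implyP cB /cB/'forall_implyP cBx /cBx/implyP.
Qed.

Lemma edge_block x y : e x y -> exists2 B, block e B & x \in B /\ y \in B.
Proof.
move=> exy; have yx : y != x by apply: contraTneq exy => ->; rewrite e_irr.
have [B bB [xB yB _]] := block_of_detour e_sym exy exy yx (connect0 _ _).
by exists B.
Qed.

(** If two blocks share [x] and [y], any other vertices [z] and [w] of theirs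
    are joined outside [x] through [y], hence adjacent; so the union of the
    two blocks is a clique, and maximality applies. *)
Lemma block_unique B1 B2 x y :
    block e B1 -> block e B2 -> x != y ->
    x \in B1 -> y \in B1 -> x \in B2 -> y \in B2 ->
  B1 = B2.
Proof.
move=> b1 b2 xy x1 y1 x2 y2.
have to_y B z : block e B -> x \in B -> y \in B -> z \in B -> z != x ->
    connect (induced e (~: [set x])) z y.
  move=> bB xB yB zB zx; have [-> // | zy] := eqVneq z y.
  by apply: connect1; rewrite /induced /= !inE zx eq_sym xy (block_adj bB).
have adj z w : z \in B1 -> w \in B2 -> z != w -> e z w.
  move=> z1 w2 zw.
  have [zx | zx] := eqVneq z x.
    by rewrite zx in zw *; apply: (block_adj b2).
  have [wx | wx] := eqVneq w x.
    by rewrite wx in zw *; apply: (block_adj b1).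
  have zw_con : connect (induced e (~: [set x])) z w.
    apply: connect_trans (to_y _ _ b1 x1 y1 z1 zx) _.
    by rewrite connect_induced_sym // (to_y _ _ b2).
  have exz : e x z by apply: (block_adj b1); rewrite // eq_sym.
  have exw : e x w by apply: (block_adj b2); rewrite // eq_sym.
  have [B bB [_ zB wB]] := block_of_detour e_sym exz exw zx zw_con.
  exact: (block_adj bB).
have nsU : nonseparable e (B1 :|: B2).
  apply: clique_nonseparable; first by apply/set0Pn; exists x; rewrite inE x1.
  apply/'forall_implyP => z zU; apply/'forall_implyP => w wU.
  apply/implyP => zw; move: zU wU; rewrite !inE => /orP[z1|z2] /orP[w1|w2].
  - exact: (block_adj b1).
  - exact: adj.
  - by rewrite e_sym adj // eq_sym.
  - exact: (block_adj b2).
case/maxsetP: b1 => _ /(_ _ nsU (subsetUl _ _)) <-.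
by case/maxsetP: b2 => _ /(_ _ nsU (subsetUr _ _)).
Qed.

(** The part of the graph hanging on the vertex [p] through the block [B]. *)
Definition branch p B : {set T} :=
  [set w | [exists z in B :\ p, connect (induced e (~: [set p])) z w]].

Lemma branchP p B w :
  reflect (exists2 z, z \in B :\ p & connect (induced e (~: [set p])) z w)
          (w \in branch p B).
Proof. by rewrite inE; apply: 'exists_in_idP. Qed.

Lemma branch_root p B : p \notin branch p B.
Proof.
apply/branchP => -[z]; rewrite !inE => /andP[zp _].
rewrite connect_induced_sym // => /connectP[[|a s] /=].
  by move=> _ zp'; rewrite zp' eqxx in zp.
by rewrite /induced /= !inE eqxx.
Qed.

(** Moving from [p] through [B] to another vertex [x] and on into another
    block makes the branch smaller: a way back to [p] avoiding [x] would put
    both blocks inside a single one. *)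
Lemma branch_decrease p x B1 B2 :
    block e B1 -> block e B2 -> B1 != B2 ->
    p \in B1 -> x \in B1 -> x != p -> x \in B2 ->
  branch x B2 \proper branch p B1.
Proof.
move=> b1 b2 b12 p1 x1 xp x2.
have p_out : p \notin branch x B2.
  apply: contraNN b12 => /branchP[z]; rewrite !inE => /andP[zx z2] con.
  have exz : e x z by apply: (block_adj b2); rewrite // eq_sym.
  have exp : e x p by apply: (block_adj b1).
  have [B bB [xB zB pB]] := block_of_detour e_sym exz exp zx con.
  apply/eqP; transitivity B; first exact: (block_unique b1 bB xp).
  by apply: (block_unique (x := x) (y := z)); rewrite // eq_sym.
apply/properP; split; last first.
  exists x; last exact: branch_root.
  by apply/branchP; exists x; rewrite // !inE xp.
apply/subsetP=> w /branchP[z zB /connectP[s sP ->]].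
apply/branchP; exists x; first by rewrite !inE xp.
have zp : z != p.
  by apply: contraNneq p_out => <-; apply/branchP; exists z.
case/setD1P: (zB) => zx z2.
have xz : connect (induced e (~: [set p])) x z.
  by apply: connect1; rewrite /induced /= !inE xp zp (block_adj b2) // eq_sym.
apply: connect_trans xz _; apply/connectP; exists s => //.
(* the path stays in the branch at [x], which does not contain [p] *)
have: z \in branch x B2 by apply/branchP; exists z.
elim: s (z) sP => //= a s IHs b /andP[ba sP] b_in.
have a_in : a \in branch x B2.
  case/branchP: b_in => z' z'B con; apply/branchP; exists z' => //.
  exact: connect_trans con (connect1 ba).
rewrite (IHs a) // andbT /induced /= !inE.
have -> /= : b != p by apply: contraNneq p_out => <-.
have -> /= : a != p by apply: contraNneq p_out => <-.
by case/and3P: ba.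
Qed.

(** By [branch_decrease], a block [B] and [p \in B] with the smallest branch
    are such a leaf and its attachment vertex. *)
Lemma leaf_block_exists P :
    {in P, forall B, block e B} -> P != set0 ->
  exists B p, B \in P /\ {in P, forall B', B' != B -> B :&: B' \subset [set p]}.
Proof.
move=> bP /set0Pn[B0 B0P].
have [p0 p0B] : exists p, p \in B0.
  by apply/set0Pn; case/maxsetP: (bP _ B0P) => /and3P[].
pose ok (u : T * {set T}) := (u.2 \in P) && (u.1 \in u.2).
have ok0 : ok (p0, B0) by rewrite /ok /= B0P.
case: (arg_minnP (fun u => #|branch u.1 u.2|) ok0) => -[p B] /andP[/= BP pB] minB.
exists B, p; split=> // B' B'P B'B; apply/subsetP => x; rewrite !inE.
case/andP=> xB xB'; apply: contraT => xp.
have := minB (x, B'); rewrite /ok /= B'P xB' => /(_ isT).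
rewrite leqNgt => /negP[]; apply: proper_card; apply: branch_decrease => //.
- exact: bP.
- exact: bP.
- by rewrite eq_sym.
Qed.

(** * Each force completes a block *)

Definition incomplete F : {set {set T}} :=
  [set B | block e B & ~~ (B \subset F)].

(** [W] is the part of the graph in which forces are currently allowed; the
    hypothesis says that it contains a component of the unfilled part as soon
    as it meets it. *)
Lemma force_completes_block W F u v :
    {in W :\: F, forall x y, y \notin F -> e x y -> y \in W} ->
    forces e W F u v ->
  #|incomplete (v |: F)| < #|incomplete F|.
Proof.
move=> closedW /andP[uF /eqP uv].
have /[!inE] /andP[/andP[vF vW] euv] : v \in [set w in W :\: F | e u w].
  by rewrite uv set11.
have [B bB [uB vB]] := edge_block euv.
apply: proper_card; apply/properP; split.
  apply/subsetP=> B'; rewrite !inE => /andP[-> /=]; apply: contraNN => sB'.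
  exact: subset_trans sB' (subsetUr _ _).
exists B; rewrite inE bB /=.
  by apply: contraNN vF => /subsetP->.
rewrite negbK; apply/subsetP=> w wB; rewrite !inE.
have [// | wv /=] := eqVneq w v; apply: contraT => wF.
have : w \in [set w in W :\: F | e u w].
  rewrite !inE wF /= (closedW v) ?inE ?vF ?(block_adj bB) // 1?eq_sym //=.
  by apply: contraNneq wF => ->.
by rewrite uv inE (negPf wv).
Qed.

Lemma card_setCU1 v F : #|~: F| <= #|~: (v |: F)|.+1.
Proof. by rewrite setCU setIC -setDE (cardsD1 v (~: F)) -add1n leq_add2r leq_b1. Qed.

Lemma forcing_steps_bound W F F' :
    {in W :\: F, forall x y, y \notin F -> e x y -> y \in W} ->
    forcing_steps e W F F' ->
  #|~: F| + #|incomplete F'| <= #|~: F'| + #|incomplete F|.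
Proof.
move=> closedW steps; elim: steps closedW => {F F'} // F F' u v fuv _ IH closedW.
have closedW' : {in W :\: (v |: F), forall x y,
    y \notin v |: F -> e x y -> y \in W}.
  move=> x; rewrite !inE negb_or -andbA => /and3P[_ xF xW] y.
  by rewrite !inE negb_or => /andP[_]; apply: closedW; rewrite inE xF.
have lt := force_completes_block closedW fuv.
apply: leq_trans (leq_add (card_setCU1 v F) (leqnn _)) _.
rewrite addSn; apply: leq_ltn_trans (IH closedW') _.
by rewrite ltn_add2l.
Qed.

Lemma components_closed F (O : {set {set T}}) :
    O \subset components e (~: F) ->
  {in (F :|: cover O) :\: F, forall x y,
     y \notin F -> e x y -> y \in F :|: cover O}.
Proof.
move=> /subsetP sO x; rewrite !inE => /andP[xF]; rewrite (negPf xF) /=.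
case/bigcupP=> U UO xU y yF exy; rewrite inE (negPf yF) /=.
apply/bigcupP; exists U => //; case/imsetP: (sO _ UO) xU => a _ ->.
rewrite !inE yF => /andP[_ ax] /=; apply: connect_trans ax (connect1 _).
by rewrite /induced /= !inE xF yF.
Qed.

(** Whatever is not paid for is forced, and completes a block. For the oracle
    move it is enough to follow the answer that opens all the selected
    components. *)
Lemma Zq_wins_bound q t F :
  Zq_wins e q t F -> #|~: F| <= t + #|incomplete F|.
Proof.
elim=> {t F} [t|t F v _ IH|t F u v fuv _ IH|t F S reply sS qS steps _ IH].
- by rewrite setCT cards0.
- apply: leq_trans (card_setCU1 v F) _; rewrite addSn ltnS.
  apply: leq_trans IH _; rewrite leq_add2l; apply: subset_leq_card.
  apply/subsetP=> B; rewrite !inE => /andP[-> /=]; apply: contraNN => sB.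
  exact: subset_trans sB (subsetUr _ _).
- apply: leq_trans (card_setCU1 v F) _; apply: leq_ltn_trans IH _.
  by rewrite ltn_add2l; apply: (force_completes_block (W := setT)) fuv.
have S0 : S != set0 by rewrite -card_gt0 (leq_ltn_trans _ qS).
have le := forcing_steps_bound (components_closed sS) (steps S (subxx _) S0).
rewrite -(leq_add2r #|incomplete (reply S)|); apply: leq_trans le _.
by rewrite addnAC leq_add2r IH.
Qed.

End BlockGraph.

(** * Zero forcing in a forest of cliques *)

Section CliqueForest.
Variable T : finType.
Implicit Types (A B C F : {set T}) (P : {set {set T}}).

(** A block graph is the [clique_union] of its blocks; taking subfamilies
    [P] allows an induction that adds the blocks one at a time. *)
Definition clique_union P : rel T :=
  [rel u v | (u != v) && [exists B in P, (u \in B) && (v \in B)]].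

Lemma clique_unionP P u v :
  reflect (u != v /\ exists2 B, B \in P & u \in B /\ v \in B)
          (clique_union P u v).
Proof.
apply: (iffP andP) => -[uv].
  by case/'exists_in_andP => B BP uvB; split=> //; exists B.
by case=> B BP uvB; split=> //; apply/'exists_in_andP; exists B.
Qed.

Lemma clique_unionC P : symmetric (clique_union P).
Proof.
by move=> u v; apply/clique_unionP/clique_unionP => -[]; rewrite eq_sym => ->;
  move=> [B BP [uB vB]]; split=> //; exists B.
Qed.

Lemma clique_unionU1r B P u w :
  w \notin B -> clique_union (B |: P) u w = clique_union P u w.
Proof.
move=> wB; apply/clique_unionP/clique_unionP => -[uw [B' B'P [uB' wB']]].
  case/setU1P: B'P => [B'B | B'P]; first by rewrite -B'B wB' in wB.
  by split=> //; exists B'.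
by split=> //; exists B'; rewrite // inE B'P orbT.
Qed.

Lemma clique_unionU1l B P u w :
  u \notin B -> clique_union (B |: P) u w = clique_union P u w.
Proof. by rewrite ![clique_union _ u w]clique_unionC; apply: clique_unionU1r. Qed.

Lemma clique_union_isolated P u w : u \notin cover P -> clique_union P u w = false.
Proof.
move=> uP; apply/clique_unionP => -[_ [B BP [uB _]]].
by case/bigcupP: uP; exists B.
Qed.

Lemma add_filled_clique_wins B P t F :
    B \subset F -> Z_wins (clique_union P) t F ->
  Z_wins (clique_union (B |: P)) t F.
Proof.
move=> sB win; elim: win sB => {t F} [t|t F v _ IH|t F u v fuv _ IH] sB.
- exact: Z_done.
- by apply: (@Z_fill _ _ _ _ v); apply/IH/(subset_trans sB)/subsetUr.
apply: (@Z_force _ _ _ _ u v); last exact/IH/(subset_trans sB)/subsetUr.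
case/andP: fuv => uF /eqP uv; rewrite /forces uF -uv; apply/eqP/setP => w.
rewrite !inE !andbT; case wF: (w \in F) => //=.
by rewrite clique_unionU1r //; apply: contraFN wF => /(subsetP sB).
Qed.

(** Until [p] is filled, the forces of the smaller graph remain possible: they
    are made by vertices outside the leaf [B], which do not see [c]. Once [p]
    is filled, [c] is the only unfilled neighbor of [d]. *)
Lemma add_leaf_wins B P p c d F :
    [disjoint B :\ p & cover P] -> B :\ p \subset F ->
    c \in B :\ p -> d \in B :\ p -> c != d ->
    Z_wins (clique_union P) 0 F ->
  Z_wins (clique_union (B |: P)) 0 (F :\ c).
Proof.
move=> disj sB cB dB cd.
have isolated x : x \in B :\ p -> forall w, clique_union P x w = false.
  by move=> xB w; rewrite clique_union_isolated // (disjointFr disj).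
have wins_after F' : B :\ p \subset F' -> p \in F' ->
    Z_wins (clique_union P) 0 F' ->
    Z_wins (clique_union (B |: P)) 0 (F' :\ c).
  move=> sB' pF' win.
  have sBF : B \subset F'.
    apply/subsetP=> x xB; have [-> // | xp] := eqVneq x p.
    by apply: (subsetP sB'); rewrite !inE xp.
  apply: (@Z_force _ _ _ _ d c); last first.
    by rewrite setD1K ?(subsetP sB') //; apply: add_filled_clique_wins.
  rewrite /forces !inE eq_sym cd (subsetP sB') //=.
  apply/eqP/setP => w; rewrite !inE !andbT negb_and negbK.
  have [-> | wc /=] := eqVneq w c.
    apply/clique_unionP; split; first by rewrite eq_sym.
    exists B; first by rewrite setU11.
    by move: cB dB; rewrite !inE => /andP[_ ->] /andP[_ ->].
  apply/andP => -[wF]; rewrite clique_unionU1r ?isolated //.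
  by apply: contraNN wF => /(subsetP sBF).
move Dt: 0 => t win; elim: win sB Dt => {t F} // [t|t F u v fuv win IH] sB Dt.
  by rewrite -Dt; apply: wins_after; rewrite ?subsetT ?inE //; apply: Z_done.
have [pF | pF] := boolP (p \in F).
  by rewrite -Dt in win *; apply: wins_after => //; apply: Z_force fuv win.
case/andP: fuv => uF /eqP uv.
have /[!inE] /andP[/andP[vF _] euv] : v \in [set w in setT :\: F | clique_union P u w].
  by rewrite uv set11.
have uBp : u \notin B :\ p by apply: contraTN euv => /isolated->.
have uB : u \notin B.
  apply: contraNN uBp => uB; rewrite !inE uB andbT.
  by apply: contraNneq pF => <-.
have vc : v != c by apply: contraNneq vF => ->; apply: (subsetP sB).
apply: (@Z_force _ _ _ _ u v); last first.
  have -> : v |: F :\ c = (v |: F) :\ c.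
    by apply/setP=> w; rewrite !inE; case: (eqVneq w v) => [-> | _]; rewrite ?vc.
  by apply: IH => //; apply: subset_trans sB (subsetUr _ _).
rewrite /forces !inE uF andbT; apply/andP; split.
  by apply: contraNneq uBp => ->.
apply/eqP; rewrite -uv; apply/setP => w; rewrite !inE !andbT clique_unionU1l //.
have [-> | //] := eqVneq w c.
by rewrite clique_unionC isolated // !andbF.
Qed.

(** Each leaf, when added back, contributes one unfilled vertex outside the
    other cliques; the leaf hypothesis makes the cliques a forest. *)
Lemma white_set P :
    {in P, forall B, 2 < #|B|} ->
    (forall Q : {set {set T}}, Q \subset P -> Q != set0 -> exists B p, B \in Q /\
       {in Q, forall B', B' != B -> B :&: B' \subset [set p]}) ->
  exists C, [/\ C \subset cover P, #|C| = #|P|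
              & Z_wins (clique_union P) 0 (~: C)].
Proof.
move Dn: #|P| => n; elim: n P Dn => [|n IHn] P Dn sizeP leafP.
  exists set0; rewrite sub0set cards0 setC0; split=> //; exact: Z_done.
have P0 : P != set0 by rewrite -card_gt0 Dn.
have [B [p [BP leafB]]] := leafP P (subxx _) P0.
have sP : P :\ B \subset P := subD1set _ _.
have [|||C [sC cardC win]] := IHn (P :\ B).
- by apply/eqP; rewrite -eqSS -Dn (cardsD1 B P) BP.
- by move=> B' /(subsetP sP); apply: sizeP.
- by move=> Q sQ; apply: leafP; apply: subset_trans sQ sP.
have disj : [disjoint B :\ p & cover (P :\ B)].
  rewrite -setI_eq0; apply/eqP/setP => x; rewrite [RHS]inE.
  apply/negP => /setIP[/setD1P[xp xB] /bigcupP[B' /setD1P[B'B B'P] xB']].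
  have := subsetP (leafB B' B'P B'B) x; rewrite !inE xB xB' (negPf xp).
  by move=> /(_ isT).
have /card_gt1P[c [d [cB dB cd]]] : 1 < #|B :\ p|.
  have := sizeP B BP; rewrite (cardsD1 p B).
  by case: (p \in B) => //= /ltnW.
have cC : c \notin C.
  by apply/negP => /(subsetP sC); rewrite (disjointFr disj cB).
exists (c |: C); split.
- apply/subsetP => x /setU1P[-> | /(subsetP sC)].
    by apply/bigcupP; exists B => //; case/setD1P: cB.
  by case/bigcupP=> B' B'P xB'; apply/bigcupP; exists B'; rewrite ?(subsetP sP).
- by rewrite cardsU1 cC cardC.
have -> : ~: (c |: C) = (~: C) :\ c by rewrite setCU setDE setIC.
rewrite -(setD1K BP); apply: (add_leaf_wins disj) cB dB cd win.
by rewrite subsetC -disjoints_subset disjoint_sym (disjointWr sC).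
Qed.

End CliqueForest.

(** * The two numbers *)

Lemma Z_wins_paid (T : finType) (e : rel T) (F A : {set T}) t :
  Z_wins e t (A :|: F) -> Z_wins e (#|A| + t) F.
Proof.
move Dn: #|A| => n; elim: n A F Dn => [|n IHn] A F Dn.
  by rewrite (cards0_eq Dn) set0U.
have [a aA] : exists a, a \in A by apply/card_gt0P; rewrite Dn.
move=> win; apply: (@Z_fill _ _ _ _ a).
apply: (IHn (A :\ a)); last by rewrite setUCA setUA setD1K.
by apply/eqP; rewrite -eqSS -Dn (cardsD1 a A) aA.
Qed.

Theorem theorem4p1 (T : finType) (e : rel T)
    (e_sym : symmetric e) (e_irr : irreflexive e)
    (G_block : block_graph e)
    (G_size : forall B : {set T}, block e B -> 2 < #|B|)
    (q : nat) :
  Zq_number e q = zero_forcing_number e.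
Proof.
apply/eqP; rewrite eqn_leq /Zq_number /zero_forcing_number.
case: ex_minnP => s /asboolP s_wins s_min.
case: ex_minnP => t /asboolP t_wins t_min.
apply/andP; split; first by apply/s_min/asboolP/Z_wins_Zq.
pose P := [set B | block e B].
have eP : clique_union P = e.
  apply/funext => u; apply/funext => v; apply/clique_unionP/idP.
    case=> uv [B]; rewrite inE => bB [uB vB].
    exact: (block_adj G_block bB).
  move=> euv; split; first by apply: contraTneq euv => ->; rewrite e_irr.
  have [B bB uvB] := edge_block e_sym e_irr euv.
  by exists B; rewrite // inE.
have [||C [_ cardC]] := @white_set T P.
- by move=> B; rewrite inE; apply: G_size.
- move=> Q sQ; apply: (leaf_block_exists e_sym G_block) => B /(subsetP sQ).
  by rewrite inE.
rewrite eP -[~: C]setU0 => /Z_wins_paid; rewrite addn0 => C_wins.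
apply: leq_trans (t_min _ (asboolT C_wins)) _.
have := Zq_wins_bound e_sym e_irr G_block s_wins.
rewrite setC0 cardsT -(cardsC C) cardC addnC => le.
rewrite -(leq_add2r #|P|); apply: leq_trans le _.
rewrite leq_add2l; apply: subset_leq_card; apply/subsetP => B.
by rewrite !inE => /andP[].
Qed.
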